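(* Let $D$ be a deck of order $n$, length $\ell$, with $c$ cards, and let $M=\max_{s\in S}m(s)$ be the highest multiplicity. The following are equivalent: 1. $D$ is $M$-symmetric; 2. $cn=\ell M$; 3. $c=n(M-1)+1$; 4. there exists a card $C$ such that every symbol on $C$ has multiplicity $M$.
   Context: A deck consists of a finite set $S$ of symbols together with a finite collection $D$ of distinct cards, each card being a subset of $S$, satisfying: (D1) any two distinct cards have exactly one symbol in common; (D2) every symbol of $S$ lies on at least two cards; (D3) every card contains at least two symbols; (D4) all cards have the same cardinality $n$ (the order); (D5) $S$ is nonempty. $\ell=|S|$ is the length and $c=|D|$ the number of cards. For $s\in S$, the multiplicity $m(s)$ is the number of cards containing $s$. A deck is $M$-symmetric if every symbol has multiplicity $M$. *)

(* Defs.v *)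
From mathcomp Require Import all_boot.

Set Implicit Arguments.
Unset Strict Implicit.
Unset Printing Implicit Defensive.

(* The finite set of symbols is a finType S, so the length is #|S|; a
   collection of distinct cards is a set of subsets of S, so the number of
   cards is #|D|. *)

Definition multiplicity (S : finType) (D : {set {set S}}) (s : S) : nat :=
  #|[set C in D | s \in C]|.

Record is_deck (S : finType) (D : {set {set S}}) (n : nat) : Prop := IsDeck {
  deck_meet : forall C1 C2 : {set S},
    C1 \in D -> C2 \in D -> C1 != C2 -> #|C1 :&: C2| = 1;
  deck_symbol : forall s : S, 2 <= multiplicity D s;
  deck_card : forall C : {set S}, C \in D -> 2 <= #|C|;
  deck_order : forall C : {set S}, C \in D -> #|C| = n;
  deck_nonempty : 0 < #|S|
}.

(* The maximum is over a nonempty range when D is a deck (deck_nonempty), so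
   the default value 0 of \max plays no role. *)
Definition highest_multiplicity (S : finType) (D : {set {set S}}) : nat :=
  \max_(s : S) multiplicity D s.

Definition symmetric_deck (S : finType) (D : {set {set S}}) (M : nat) : Prop :=
  forall s : S, multiplicity D s = M.

(* Main.v *)
Require Import Defs.
From mathcomp Require Import all_boot.
From mathcomp Require Import zify.

(** Double counting gives [c n = sum_s m(s)], and, since two distinct cards meet
    in one symbol, [sum_(s in C) m(s) = n + c - 1] for every card [C].  As each
    [m(s)] is at most [M], (2) and (3) are the equality cases of these sums:
    (3) does not mention [C], so if all symbols of one card have multiplicity [M],
    the same is true of every card, hence of every symbol. *)

(** Incidences between symbols of [A] and cards of [D], counted first by symbol and then by card. *)
Lemma sum_multiplicity (S : finType) (D : {set {set S}}) (A : {set S}) :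
  \sum_(s in A) multiplicity D s = \sum_(C in D) #|A :&: C|.
Proof.
transitivity (\sum_(s in A) \sum_(C in D | s \in C) 1).
  apply: eq_bigr => s _; rewrite sum1_card /multiplicity -[RHS]cardsE.
  by apply: eq_card => C; rewrite !inE.
rewrite (exchange_big_dep (mem D)) /=; last by move=> s C _ /andP[].
apply: eq_bigr => C CD; rewrite sum1_card -[LHS]cardsE.
by apply: eq_card => s; rewrite !inE CD.
Qed.

Lemma leq_highest_multiplicity (S : finType) (D : {set {set S}}) (s : S) :
  multiplicity D s <= highest_multiplicity D.
Proof. exact: (leq_bigmax (F := multiplicity D)). Qed.

(** A sum of terms bounded by a constant attains the total bound only if every term does. *)
Lemma eq_sum_multiplicity (S : finType) (D : {set {set S}}) (A : {set S}) :
  \sum_(s in A) multiplicity D s = #|A| * highest_multiplicity D <->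
  (forall s, s \in A -> multiplicity D s = highest_multiplicity D).
Proof.
rewrite -sum_nat_const; split=> [/eqP | mulA]; last exact: eq_bigr.
have [_ ->] := leqif_sum (fun s (_ : s \in A) =>
  leqif_eq (leq_highest_multiplicity _ D s)).
by move/forall_inP => mulA s sA; apply/eqP/mulA.
Qed.

Section Deck.

Variables (S : finType) (D : {set {set S}}) (n : nat).
Hypothesis deckD : is_deck D n.

Lemma sum_multiplicity_deck : \sum_s multiplicity D s = #|D| * n.
Proof.
transitivity (\sum_(s in [set: S]) multiplicity D s).
  by apply: eq_bigl => s; rewrite inE.
rewrite sum_multiplicity -sum_nat_const; apply: eq_bigr => C CD.
by rewrite setTI (deck_order deckD).
Qed.

(** In the double count, [C] meets itself in [n] symbols and each of the other [#|D| - 1] cards in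
    one. The [+ 1] on the left avoids truncated subtraction. *)
Lemma sum_multiplicity_card (C : {set S}) :
  C \in D -> \sum_(s in C) multiplicity D s + 1 = #|D| + n.
Proof.
move=> CD; rewrite sum_multiplicity (big_setD1 C) //= setIid (deck_order deckD) //.
rewrite (eq_bigr (fun=> 1)) => [|C']; last first.
  by case/setD1P=> neqC C'D; rewrite (deck_meet deckD) // eq_sym.
by rewrite sum1_card (cardsD1 C D) CD; lia.
Qed.

Lemma exists_card (s : S) : exists2 C, C \in D & s \in C.
Proof.
have /card_gt0P[C] : 0 < multiplicity D s by apply: ltnW (deck_symbol deckD s).
by rewrite inE => /andP[CD sC]; exists C.
Qed.

Lemma highest_multiplicity_gt0 : 0 < highest_multiplicity D.
Proof.
have /card_gt0P[s _] := deck_nonempty deckD.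
apply: leq_trans (leq_highest_multiplicity _ D s).
exact: ltnW (deck_symbol deckD s).
Qed.

Lemma number_of_cardsE (C : {set S}) : C \in D ->
  #|D| = n * (highest_multiplicity D - 1) + 1 <->
  (forall s, s \in C -> multiplicity D s = highest_multiplicity D).
Proof.
move=> CD; rewrite -eq_sum_multiplicity (deck_order deckD) //.
have := sum_multiplicity_card _ CD; have := highest_multiplicity_gt0.
(* Positivity lets the maximum be written [m.+1], so that [- 1] is a true subtraction;
   [n * m.+1 = n + n * m] then cancels the [n] of the card sum. *)
by case: (highest_multiplicity D) => // m _; rewrite subn1 mulnS /=; lia.
Qed.

End Deck.

Theorem mainTheorem12 (S : finType) (D : {set {set S}}) (n l c M : nat)
    (deckD : is_deck D n) (def_l : l = #|S|) (def_c : c = #|D|)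
    (def_M : M = highest_multiplicity D) :
  [<-> symmetric_deck D M;
       c * n = l * M;
       c = n * (M - 1) + 1;
       exists C : {set S},
         C \in D /\ (forall s : S, s \in C -> multiplicity D s = M)].
Proof.
subst l c M.
have /card_gt0P[s0 _] := deck_nonempty deckD.
(* A symbol exists and lies on some card; this card is the witness for (4). *)
have [C0 C0D _] := exists_card _ _ _ deckD s0.
tfae.
- move=> symD; rewrite -(sum_multiplicity_deck _ _ _ deckD) -sum_nat_const.
  by apply: eq_bigr => s _; apply: symD.
- rewrite -(sum_multiplicity_deck _ _ _ deckD) -cardsT => sumE.
  apply/(number_of_cardsE _ _ _ deckD _ C0D) => s _.
  (* Here (2) is the equality case over all symbols, which in particular covers those of [C0]. *)
  apply: (eq_sum_multiplicity _ D [set: S]).1; last by rewrite inE.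
  by rewrite -sumE; apply: eq_bigl => t; rewrite inE.
- by move=> cE; exists C0; split=> //; apply/(number_of_cardsE _ _ _ deckD _ C0D).
- case=> C [CD /(number_of_cardsE _ _ _ deckD _ CD) cE] s.
  (* The count [cE] obtained from [C] applies equally to a card [C'] through the arbitrary symbol
     [s]. *)
  have [C' C'D sC'] := exists_card _ _ _ deckD s.
  exact: (number_of_cardsE _ _ _ deckD _ C'D).1 cE s sC'.
Qed.
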